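(* For $n\in\mathbb{N}$ let $H_n:=\mathcal{A}_n\cup\mathcal{B}_n\cup\Lambda_n\cup\Delta_n\cup\{\xi\}$. Then $\langle H_n\rangle=F_{\mathbb{N}}$ for all $n\in\mathbb{N}$.
   Context: $\mathbb{N}=\{1,2,3,\ldots\}$. The zig-zag order $\preceq$ on $\mathbb{N}$ is the partial order consisting of the diagonal together with the relation $\prec$ defined, for each $n\in\mathbb{N}$, by $n\prec n+1$ if $n$ is odd and $n+1\prec n$ if $n$ is even. $F_{\mathbb{N}}$ is the semigroup, under composition, of all maps $\alpha:\mathbb{N}\to\mathbb{N}$ such that $x\preceq y$ implies $x\alpha\preceq y\alpha$. Maps are written on the right, so $x(\alpha\beta)=(x\alpha)\beta$. $\langle G\rangle$ denotes the subsemigroup generated by $G$. A non-empty subset of $\mathbb{N}$ is convex if it is an interval with respect to the usual order $\le$. For $\alpha\in F_{\mathbb{N}}$: $\mathrm{nb}(\alpha):=\{a\in\mathbb{N}: a\alpha=(a+1)\alpha\}$; $\mathrm{c}(\alpha):=\left|\bigcup\{a\alpha^{-1}: a\in\mathrm{im}\,\alpha,\ |a\alpha^{-1}|\ge 2\}\right|$; for $m\in\mathbb{N}$, $M_\alpha^m$ is the set of all convex $X\subseteq\mathbb{N}$ with $|X|=m$, $|X\alpha|=1$, and $|Y\alpha|>1$ for every convex $Y\subseteq\mathbb{N}$ with $X\subsetneq Y$; $M_\alpha:=\bigcup_{m\in\mathbb{N}}M_\alpha^m$; $M_\alpha^*:=M_\alpha\setminus M_\alpha^1$. For $n\in\mathbb{N}$: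 - $\Lambda_n:=\{\alpha\in F_{\mathbb{N}}: |\mathrm{nb}(\alpha)|=0,\ \mathrm{c}(\alpha)>0,\ 1\alpha\ge n,\ |\{1,2,\ldots,n\}\alpha|=n\}$. - $\Delta_n:=\{\alpha\in F_{\mathbb{N}}: 1\alpha\ge n,\ |\{1,2,\ldots,n\}\alpha|=n,\ |M_\alpha^*|=\aleph_0\}$. - $\alpha_n$ is the map with $x\alpha_n=x$ for $x<n$ and $x\alpha_n=n$ for $x\ge n$; $\mathcal{A}_n:=\{\alpha_i: i\ge n\}$. - Let $\mathcal{B}:=\{\alpha\in F_{\mathbb{N}}: |\mathrm{nb}(\alpha)|=2,\ \mathrm{c}(\alpha)=3,\ \mathrm{im}\,\alpha=\mathbb{N}\}$; $\beta_n$ is the unique $\beta\in\mathcal{B}$ with $\min(\mathrm{nb}(\beta))=n$ (explicitly $x\beta_n=x$ for $x<n$, $x\beta_n=n$ for $x\in\{n,n+1,n+2\}$, $x\beta_n=x-2$ for $x>n+2$); $\mathcal{B}_n:=\{\beta_i: i\ge n\}$. - $\xi$ is the map $x\xi:=x+2$ for all $x\in\mathbb{N}$. *)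

(* Defs.v *)
From HB Require Import structures.
From mathcomp Require Import all_boot all_classical zify.

Set Implicit Arguments.
Unset Strict Implicit.
Unset Printing Implicit Defensive.

Local Open Scope classical_set_scope.
Local Open Scope card_scope.
Local Open Scope nat_scope.

(* N = {1, 2, 3, ...}; the coercion to nat makes <=, <, odd and + usable on it. *)
Record natpos := NatPos { natpos_val :> nat; _ : 0 < natpos_val }.
HB.instance Definition _ := [isSub for natpos_val].
HB.instance Definition _ := [Choice of natpos by <:].

(* k as an element of N when k > 0; the junk value at k = 0 is 1. *)
Definition toN (k : nat) : natpos := NatPos (ltn0Sn k.-1).

Definition succN (n : natpos) : natpos := NatPos (ltn0Sn n).

Inductive zprec : natpos -> natpos -> Prop :=
| zprec_odd (n : natpos) : odd n -> zprec n (succN n)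
| zprec_even (n : natpos) : ~~ odd n -> zprec (succN n) n.

Definition zle (x y : natpos) : Prop := x = y \/ zprec x y.

Definition FN : set (natpos -> natpos) :=
  [set a | forall x y, zle x y -> zle (a x) (a y)].

(* Maps are written on the right, so the product of a and b is
   a \; b = fun x => b (a x). *)
Definition mul_closed (S : set (natpos -> natpos)) : Prop :=
  forall a b, S a -> S b -> S (a \; b).

Definition generated (G : set (natpos -> natpos)) : set (natpos -> natpos) :=
  smallest mul_closed G.

Definition convex (X : set natpos) : Prop :=
  X !=set0 /\ forall x y z : natpos, X x -> X z -> x <= y <= z -> X y.

Definition nb (a : natpos -> natpos) : set natpos := [set x | a x = a (succN x)].

(* c(a) is the cardinality of this set. *)
Definition cset (a : natpos -> natpos) : set natpos :=
  \bigcup_(y in [set y | range a y /\ `I_2 #<= a @^-1` [set y]])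
     a @^-1` [set y].

Definition Mm (a : natpos -> natpos) (m : natpos) : set (set natpos) :=
  [set X | [/\ convex X, X #= `I_m, a @` X #= `I_1 &
    forall Y, convex Y -> X `<` Y -> ~~ (a @` Y #<= `I_1)]].

Definition MM (a : natpos -> natpos) : set (set natpos) := \bigcup_m Mm a m.

Definition Mstar (a : natpos -> natpos) : set (set natpos) :=
  MM a `\` Mm a (toN 1).

Definition upto (n : natpos) : set natpos := [set x : natpos | x <= n].

Definition Lambda (n : natpos) : set (natpos -> natpos) :=
  [set a | [/\ FN a, nb a #= `I_0, ~~ (cset a #<= `I_0),
    n <= a (toN 1) & a @` upto n #= `I_n]].

Definition Delta (n : natpos) : set (natpos -> natpos) :=
  [set a | [/\ FN a, n <= a (toN 1), a @` upto n #= `I_n &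
    Mstar a #= [set: nat]]].

Definition alpha (n x : natpos) : natpos := if x < n then x else n.

Definition calA (n : natpos) : set (natpos -> natpos) :=
  [set alpha i | i in [set i : natpos | n <= i]].

Definition calB : set (natpos -> natpos) :=
  [set b | [/\ FN b, nb b #= `I_2, cset b #= `I_3 & range b = [set: natpos]]].

Definition is_min (X : set natpos) (n : natpos) : Prop :=
  X n /\ forall x, X x -> n <= x.

(* beta n is the unique b in calB with min (nb b) = n, see betaP below. *)
Definition beta (n x : natpos) : natpos :=
  if x < n then x else if x <= n + 2 then n else toN (x - 2).

Definition calBn (n : natpos) : set (natpos -> natpos) :=
  [set beta i | i in [set i : natpos | n <= i]].

Definition xi (x : natpos) : natpos := toN (x + 2).

Definition Hn (n : natpos) : set (natpos -> natpos) :=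
  calA n `|` calBn n `|` Lambda n `|` Delta n `|` [set xi].

Lemma card_seq (s : seq natpos) : uniq s -> [set x | x \in s] #= `I_(size s).
Proof.
move=> us; have -> : [set x | x \in s] = nth (toN 1) s @` `I_(size s).
  apply/seteqP; split=> x /=; last by case=> i /= il <-; rewrite mem_nth.
  by move=> xs; exists (index x s); rewrite /= ?index_mem ?nth_index.
apply: inj_card_eq; apply: (can_in_inj (g := index^~ s)) => i;
  rewrite inE /= => il; exact: index_uniq.
Qed.

Lemma card_ge_seq (A : set natpos) (s : seq natpos) m :
  A #= `I_m -> uniq s -> {in s, forall x, A x} -> size s <= m.
Proof.
move=> Am us sA; rewrite -card_le_II.
move: (card_seq us) Am; rewrite !card_eq_le => /andP[_ h] /andP[k _].
apply: card_le_trans h _; apply: card_le_trans k.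
by apply: subset_card_le => x; apply: sA.
Qed.

Lemma card_seq_eq (A : set natpos) (s : seq natpos) m :
  uniq s -> (forall x, A x <-> x \in s) -> m = size s -> A #= `I_m.
Proof.
move=> us sA ->; have -> : A = [set x | x \in s].
  by apply/seteqP; split=> x /sA.
exact: card_seq.
Qed.

Lemma natpos_eqP (x y : natpos) : reflect (x = y) (x == y :> nat).
Proof. by apply: (iffP eqP) => [/val_inj|->]. Qed.

Lemma natpos_gt0 (x : natpos) : 0 < x. Proof. by case: x. Qed.

Lemma toN_val k : 0 < k -> toN k = k :> nat.
Proof. by case: k. Qed.

Lemma zle_nat (x y : natpos) : zle x y <->
  x = y :> nat \/ odd x /\ (y = x.+1 :> nat \/ x = y.+1 :> nat).
Proof.
split=> [[->|[n on|n on]]|]; first by left.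
- by right; split=> //; left.
- by right; split; [rewrite /= on|right].
case=> [/val_inj->|[ox [e|e]]]; first by left.
- by right; have -> : y = succN x by [apply: val_inj]; constructor.
- right; have e' : x = succN y by apply: val_inj.
  by rewrite e'; constructor; move: ox; rewrite e.
Qed.

Lemma betaE (n x : natpos) :
  beta n x = (if x < n then x : nat else if x <= n + 2 then n : nat else x - 2) :> nat.
Proof. rewrite /beta; case: ltnP => // h; case: leqP => // k; rewrite toN_val; lia. Qed.

Lemma csetP (a : natpos -> natpos) (x : natpos) :
  cset a x <-> exists2 y, x <> y & a x = a y.
Proof.
split.
  case=> z /= [_ h] axz; apply: contrapT => hN.
  suff : `I_2 #<= `I_1 by rewrite card_le_II.
  apply: card_le_trans h _.
  suff : a @^-1` [set z] `<=` [set y | y \in [:: x]].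
    move=> /subset_card_le /card_le_trans; apply.
    by have := @card_seq [:: x] isT; rewrite card_eq_le => /andP[].
  move=> y /= ayz; rewrite inE; apply/eqP; apply: contrapT => xy.
  by apply: hN; exists y; [move=> e; apply: xy|rewrite ayz].
case=> y xy axy; exists (a x) => //=; split; first by exists x.
have u : uniq [:: x; y] by rewrite /= inE andbT; apply/eqP.
have := card_seq u; rewrite card_eq_le => /andP[_ h].
apply: card_le_trans h _; apply: subset_card_le => z /=.
by rewrite !inE => /orP[] /eqP->.
Qed.

Lemma beta_calB (n : natpos) : calB (beta n) /\ is_min (nb (beta n)) n.
Proof.
have nbP x : nb (beta n) x <-> x \in [:: n; succN n].
  rewrite !inE -!(inj_eq val_inj) /=; split.
    by move/(congr1 natpos_val); rewrite !betaE /=; have := natpos_gt0 x; do ?case: ifP; lia.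
  by move=> h; apply/val_inj; rewrite /= !betaE /=; have := natpos_gt0 n; do ?case: ifP; lia.
split; last first.
  split; first by apply/nbP; rewrite inE eqxx.
  by move=> x /nbP; rewrite !inE -!(inj_eq val_inj) /=; lia.
split.
- move=> x y /zle_nat h; apply/zle_nat; rewrite !betaE.
  have := natpos_gt0 x; have := natpos_gt0 y; have := natpos_gt0 n; do ?case: ifP; lia.
- apply: card_seq_eq nbP _ => //=.
  by rewrite inE -!(inj_eq val_inj) /=; lia.
- apply: (@card_seq_eq _ [:: n; succN n; succN (succN n)]) => //=.
    by rewrite !inE -!(inj_eq val_inj) /=; lia.
  move=> x; rewrite csetP !inE -!(inj_eq val_inj) /=; split.
    case=> y xy /(congr1 natpos_val); rewrite !betaE.
    have : x <> y :> nat by move/val_inj.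
    by have := natpos_gt0 x; have := natpos_gt0 y; do ?case: ifP; lia.
  move=> h; have [e|ne] := eqVneq (x : nat) n.
    exists (succN n); first by move=> /(congr1 natpos_val) /=; lia.
    by apply/val_inj; rewrite /= !betaE /= e; do ?case: ifP; lia.
  exists n; first by move=> /(congr1 natpos_val) /=; lia.
  by apply/val_inj; rewrite /= !betaE; do ?case: ifP; lia.
- apply/seteqP; split=> // y _; have y0 := natpos_gt0 y.
  exists (toN (if y < n then y : nat else y + 2)) => //.
  apply/val_inj; rewrite /= betaE toN_val; do ?case: ifP; lia.
Qed.

(* an injective walk on N with steps +-1 can never step down *)
Lemma walk_up (g : nat -> nat) :
  (forall x, g x.+1 = (g x).+1 \/ g x = (g x.+1).+1) ->
  injective g -> forall x, g x.+1 = (g x).+1.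
Proof.
move=> st gi x; case: (st x) => // e.
have down k : g x = g (x + k) + k /\ g (x + k) = (g (x + k).+1).+1.
  elim: k => [|k [IH1 IH2]]; first by rewrite !addn0.
  rewrite !addnS; split; first by lia.
  case: (st (x + k).+1) => // e'.
  have e2 : g (x + k) = g (x + k).+2 by lia.
  by move: (gi _ _ e2); lia.
by have [] := down (g x).+1; lia.
Qed.

Lemma betaP (n : natpos) (b : natpos -> natpos) :
  calB b /\ is_min (nb b) n <-> b = beta n.
Proof.
split=> [[[Fb nb2 c3 rb] [nbn nmin]]|->]; last exact: beta_calB.
have n0 := natpos_gt0 n.
have nbc x : nb b x -> cset b x /\ cset b (succN x).
  move=> h; have xs : x <> succN x by move/(congr1 natpos_val) => /=; lia.
  by split; apply/csetP; [exists (succN x)|exists x => // /esym].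
have nbS x : nb b x -> x = n \/ x = succN n.
  move=> h; apply: contrapT => /not_orP[xn xsn].
  have nx : n <= x by apply: nmin.
  have [c1 c2] := nbc _ nbn; have [c1' c2'] := nbc _ h.
  move: xn xsn => /natpos_eqP xn /natpos_eqP /= xsn.
  have us : uniq [:: n; succN n; x; succN x].
    by rewrite /= !inE -!(inj_eq val_inj) /=; lia.
  suff /(card_ge_seq c3 us) : {in [:: n; succN n; x; succN x], forall y, cset b y}.
    by [].
  by move=> y; rewrite !inE => /or4P[] /eqP->.
have nbn1 : nb b (succN n).
  apply: contrapT => h.
  suff nbn' x : nb b x <-> x \in [:: n].
    by have := @card_seq_eq _ [:: n] 1 isT nbn' erefl; rewrite (card_eql nb2) => /card_eq_II.
  by rewrite inE; split=> [/[dup] hx /nbS[->|e]|/eqP->] //; case: h; rewrite -e.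
have [c1 c2] := nbc _ nbn; have [_ c2'] := nbc _ nbn1.
have cs x : cset b x -> n <= x <= n + 2.
  move=> cx; apply/negPn/negP => hx.
  have us : uniq [:: n; succN n; succN (succN n); x].
    by rewrite /= !inE -!(inj_eq val_inj) /=; lia.
  suff /(card_ge_seq c3 us) :
    {in [:: n; succN n; succN (succN n); x], forall y, cset b y} by [].
  by move=> y; rewrite !inE => /or4P[] /eqP->.
have bI (x y : natpos) : b x = b y ->
    x = y :> nat \/ (n <= x <= n + 2) && (n <= y <= n + 2).
  move=> e; case: (pselect (x = y)) => [->|xy]; first by left.
  have cx : cset b x by apply/csetP; exists y.
  have cy : cset b y by apply/csetP; exists x => //; exact/nesym.
  by right; rewrite !cs.
pose d k := if k < n then k.+1 else k.+3.
have d0 k : 0 < d k by rewrite /d; case: ifP.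
pose g k : nat := b (toN (d k)).
have gI : injective g.
  move=> k l /val_inj /bI; rewrite !toN_val // /d.
  by case: ifP; case: ifP; lia.
have st (x : natpos) : ~ nb b x ->
    b (succN x) = (b x).+1 :> nat \/ b x = (b (succN x)).+1 :> nat.
  move=> h; have ne : b x <> b (succN x) :> nat by move/val_inj.
  case: (boolP (odd x)) => ox.
    have /Fb /zle_nat : zle x (succN x) by right; constructor.
    by lia.
  have /Fb /zle_nat : zle (succN x) x by right; constructor.
  by lia.
have b2 : b (toN (n + 2)) = b n :> nat.
  rewrite nbn nbn1; congr (natpos_val (b _)); apply/val_inj => /=; lia.
have stN m : 0 < m -> m < n \/ n + 2 <= m ->
    b (toN m.+1) = (b (toN m)).+1 :> nat \/ b (toN m) = (b (toN m.+1)).+1 :> nat.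
  move=> m0 hm; have <- : succN (toN m) = toN m.+1.
    by apply/val_inj => /=; lia.
  by apply: st => /nbS[] /(congr1 natpos_val); move=> /=; lia.
have gS k : g k.+1 = (g k).+1 \/ g k = (g k.+1).+1.
  rewrite /g; have [kn|nk] := ltnP k.+1 n.
    have -> : d k.+1 = k.+2 by rewrite /d kn.
    have -> : d k = k.+1 by rewrite /d ltnW.
    by apply: stN => //; left.
  have -> : d k.+1 = k.+4 by rewrite /d ltnNge nk.
  have -> : b (toN (d k)) = b (toN k.+3) :> nat.
    rewrite /d; case: ifP => // kn; have e : n = k.+1 :> nat by lia.
    have -> : toN k.+1 = n by apply/val_inj => /=; lia.
    by rewrite -b2; congr (natpos_val (b _)); apply/val_inj => /=; lia.
  by apply: stN => //; right; lia.
have gE k : g k = g 0 + k.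
  by elim: k => [|k IH]; rewrite ?addn0 // walk_up // IH addnS.
have gd (x : natpos) : exists2 k, b x = g k :> nat &
    k = (if x < n then x.-1 else if x <= n + 2 then n.-1 else x - 3).
  exists (if x < n then x.-1 else if x <= n + 2 then n.-1 else x - 3) => //.
  set K := (X in g X).
  have x0 := natpos_gt0 x.
  have -> : g K = b (toN (if n <= x <= n + 2 then n : nat else x)).
    by rewrite /g /d /K; congr (natpos_val (b (toN _))); do ?case: ifP; lia.
  case: ifP => xn; last by congr (natpos_val (b _)); apply/val_inj => /=; lia.
  have -> : toN n = n by apply/val_inj => /=; lia.
  have [e|[e|e]] : x = n :> nat \/ x = n.+1 :> nat \/ x = (n + 2) :> nat by lia.
  - by rewrite (val_inj e).
  - by have -> : x = succN n; [apply/val_inj | rewrite -nbn].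
  - by rewrite -b2; congr (natpos_val (b _)); apply/val_inj => /=; lia.
have g0 : g 0 = 1.
  have : range b (toN 1) by rewrite rb.
  case=> x _ bx; have [k e _] := gd x.
  have := gE k; have := natpos_gt0 (b (toN (d 0))); rewrite -/(g 0) -e bx /=; lia.
apply/funext => x; apply/val_inj; rewrite /= betaE.
have [k -> ->] := gd x; rewrite gE g0.
by have := natpos_gt0 x; do ?case: ifP; lia.
Qed.

(* Main.v *)
(** Write [a = xi \; ... \; xi \; g] with [n] factors [xi], where [g] runs
    down monotonically along [1, ..., 2n] and then copies [a].  So it suffices to
    generate such [g].  If [g] has no constant step it lies in [Lambda n], and if it
    has infinitely many constant and infinitely many nonconstant steps it lies in
    [Delta n].  If it has finitely many constant steps, parity forces its last
    maximal constant block to have odd length at least 3, so [g = beta i \; g'] with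
    [n <= i] and [g'] having fewer constant steps.  If it is eventually constant,
    [g = alpha m \; d] where [d] follows [g] up to [m] and then increases. *)
Require Import Defs.
From mathcomp Require Import all_boot all_classical zify.

Set Implicit Arguments.
Unset Strict Implicit.
Unset Printing Implicit Defensive.

Local Open Scope classical_set_scope.
Local Open Scope card_scope.
Local Open Scope nat_scope.

(** * Steps of order-preserving maps; closure of the generated semigroup *)

(** Only neighbours are strictly comparable, the odd one always being the smaller. Hence a
    nonconstant step must send odd to odd and even to even: all parity arguments below rest on
    this. *)
Lemma FN_step (a : natpos -> natpos) : FN a <-> forall x : natpos,
  a (succN x) = a x :> nat \/ odd (a x) = odd x /\
  (a (succN x) = (a x).+1 :> nat \/ a x = (a (succN x)).+1 :> nat).
Proof.
split=> [Fa x|st x y].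
  case: (boolP (odd x)) => ox.
    have /Fa /zle_nat : zle x (succN x) by right; constructor.
    by lia.
  have /Fa /zle_nat : zle (succN x) x by right; constructor.
  by lia.
case=> [->|[z oz|z oz]]; first by left.
  by apply/zle_nat; have := st z; lia.
by apply/zle_nat; have := st z; lia.
Qed.

Lemma succN_toN k : 0 < k -> succN (toN k) = toN k.+1.
Proof. by move=> k0; apply/val_inj; rewrite /= prednK. Qed.

Lemma toN_natpos (x : natpos) : toN x = x.
Proof. by apply/val_inj; rewrite /= prednK ?natpos_gt0. Qed.

Lemma FN_toN (f : nat -> nat) : (forall k, 0 < k -> 0 < f k) ->
  (forall k, 0 < k -> f k.+1 = f k \/ odd (f k) = odd k /\
     (f k.+1 = (f k).+1 \/ f k = (f k.+1).+1)) ->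
  FN (fun x => toN (f x)).
Proof.
move=> f0 st; apply/FN_step => x; have x0 := natpos_gt0 x.
by rewrite !toN_val ?f0 //; apply: st.
Qed.

Lemma FN_comp : mul_closed FN.
Proof. by move=> a b Fa Fb x y /Fa /Fb. Qed.

Lemma Hn_FN n : Hn n `<=` FN.
Proof.
move=> a [[[[[i _ <-]|[i _ <-]]|]|]|->].
- apply/FN_step => x; rewrite /alpha; case: ifP; case: ifP => /=; lia.
- by have [[]] := beta_calB i.
- by case.
- by case.
- by apply: (@FN_toN (fun x => x + 2)) => k; lia.
Qed.

Lemma generated_comp G : mul_closed (generated G).
Proof.
by move=> a b ha hb M cGM; apply: cGM.1; [apply: ha | apply: hb].
Qed.

Lemma generated_sub G : G `<=` generated G.
Proof. exact: sub_gen_smallest. Qed.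

(** Each factor [xi] on the left discards the first two values of [g]. *)
Lemma generated_shift n (g : natpos -> natpos) k :
  generated (Hn n) g -> generated (Hn n) (fun x => g (toN (x + k.*2))).
Proof.
elim: k g => [|k IH] g hg.
  suff -> : (fun x : natpos => g (toN (x + 0.*2))) = g by [].
  by apply/funext => x; rewrite addn0 toN_natpos.
have {}hg : generated (Hn n) (xi \; g).
  by apply: generated_comp => //; apply: generated_sub; right.
move: (IH _ hg); congr generated; apply/funext => x /=.
congr (g (toN _)); rewrite toN_val; have := natpos_gt0 x; lia.
Qed.

(** * Maps with a descending start, and membership in [Lambda n] *)

(* The bound [n.+1] rather than [n] makes [g] decrease at least once, which rules
   out injectivity when [g] has no constant step. *)
Definition descends (n : natpos) (g : natpos -> natpos) : Prop :=
  n <= g (toN 1) /\ forall x : natpos, x <= n.+1 -> g x + x = (g (toN 1)).+1.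

Lemma descends_nb n g x : descends n g -> nb g x -> n < x.
Proof.
move=> [_ dg] nbx; rewrite ltnNge; apply/negP => xn.
by have := dg x; have := dg (succN x); rewrite -nbx /=; lia.
Qed.

Lemma descends_card_image n g : descends n g -> g @` upto n #= `I_n.
Proof.
move=> [_ dg].
have -> : g @` upto n = (fun i => g (toN i.+1)) @` `I_n.
  apply/seteqP; split=> y [x xn <-]; rewrite /= in xn; last by exists (toN x.+1).
  have x0 := natpos_gt0 x; exists x.-1; first by rewrite /= prednK.
  by rewrite prednK // toN_natpos.
apply: inj_card_eq => i j; rewrite !inE /= => ilt jlt e.
by have := dg (toN i.+1); have := dg (toN j.+1); rewrite e !toN_val //; lia.
Qed.

Lemma descends_Lambda n g :
  FN g -> descends n g -> (forall x, ~ nb g x) -> Lambda n g.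
Proof.
move=> Fg dg nb0; split=> //; last exact: descends_card_image; last by case: dg.
  by rewrite II0 card_eq0; apply/eqP; rewrite -subset0 => x /nb0.
(* If [cset g] were empty, [g] would be injective with all steps of size one, so by [walk_up] it
   could only increase; but it steps down from 1 to 2. *)
rewrite II0 card_le0; apply/negP => /eqP c0.
pose f k : nat := g (toN k.+1).
have fS k : f k.+1 = (f k).+1 \/ f k = (f k.+1).+1.
  rewrite /f -(@succN_toN k.+1) //.
  have [e|[_ //]] := (FN_step g).1 Fg (toN k.+1).
  by case: (nb0 (toN k.+1)); apply/val_inj.
have fI : injective f.
  move=> k l /val_inj e; apply: contrapT => kl.
  have : cset g (toN k.+1).
    by apply/csetP; exists (toN l.+1) => // /(congr1 natpos_val) /= [].
  by rewrite c0.
have := walk_up fS fI 0; rewrite /f.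
by case: dg => _ /(_ (toN 2)); have := natpos_gt0 n; rewrite /=; lia.
Qed.

(** * Maximal constant blocks and the cardinality of [Mstar] *)

(** This is the largest convex set through [x] on which [a] is constant. It may be infinite, and
    then it is not a member of [MM a]. *)
Definition block (a : natpos -> natpos) (x : natpos) : set natpos :=
  [set y | forall z : natpos, minn x y <= z <= maxn x y -> a z = a x].

Lemma block_refl a x : block a x x.
Proof. by move=> z; rewrite minnn maxnn -eqn_leq => /eqP /val_inj <-. Qed.

Lemma block_const a x y : block a x y -> a y = a x.
Proof. by apply; rewrite geq_minr leq_maxr. Qed.

Lemma convex_block a x : convex (block a x).
Proof.
split; first by exists x; apply: block_refl.
move=> u v w hu hw uvw z hz.
by have [h|h] := leqP z x; [apply: hu | apply: hw]; lia.
Qed.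

Lemma block_image a x : a @` block a x = [set a x].
Proof.
apply/seteqP; split=> [_ [y /block_const ? <-] //|_ ->].
by exists x => //; apply: block_refl.
Qed.

Lemma const_convex_sub_block a (Y : set natpos) x :
  convex Y -> a @` Y #<= `I_1 -> Y x -> Y `<=` block a x.
Proof.
move=> [_ cY] Y1 Yx y Yy z hz.
have Yz : Y z.
  by have [xy|yx] := leqP x y; [apply: cY Yx Yy _|apply: cY Yy Yx _]; lia.
apply: contrapT => ne.
have us : uniq [:: a z; a x] by rewrite /= inE andbT; apply/eqP.
suff : `I_2 #<= `I_1 by rewrite card_le_II.
apply: card_le_trans Y1.
have := card_seq us; rewrite card_eq_le => /andP[_ h].
apply: card_le_trans h _; apply: subset_card_le => w /=.
by rewrite !inE => /orP[] /eqP->; [exists z|exists x].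
Qed.

Lemma MM_block a X : MM a X -> exists x, X = block a x.
Proof.
move=> [m _ [cX _ X1 maxX]]; have [x Xx] := cX.1; exists x.
have sub : X `<=` block a x.
  apply: const_convex_sub_block => //.
  by move: X1; rewrite card_eq_le => /andP[].
apply/seteqP; split=> //; apply: contrapT => ne.
move: (maxX _ (convex_block a x) (conj sub ne)); apply/negP; rewrite negbK.
by rewrite block_image; have := card_set1 (x := a x); rewrite card_eq_le => /andP[].
Qed.

Lemma finite_bounded (A : set natpos) m : (forall x, A x -> x <= m) -> finite_set A.
Proof.
move=> Am; apply: (@sub_finite_set _ _ (toN @` `I_m.+1)); last first.
  exact/finite_image/finite_II.
by move=> x /Am xm; exists (x : nat) => //; apply: toN_natpos.
Qed.

Lemma finite_has_bound (A : set natpos) :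
  finite_set A -> exists m : nat, forall x, A x -> x <= m.
Proof.
move=> /finite_seqP[s ->]; exists (\max_(x <- s) x) => x /= xs.
exact: leq_bigmax_seq.
Qed.

(** The nonconstant step at [m] stops the block, which is therefore finite; the constant step at [x]
    puts both [x] and [succN x] into it, which excludes size one. *)
Lemma block_Mstar a x (m : natpos) :
  nb a x -> x <= m -> ~ nb a m -> Mstar a (block a x).
Proof.
move=> nbx xm nbm.
have fb : finite_set (block a x).
  apply: (@finite_bounded _ m) => y hy; rewrite leqNgt; apply/negP => my.
  by apply: nbm; rewrite /nb /= hy ?[RHS]hy //=; lia.
have xb := @block_refl a x.
have sxb : block a x (succN x).
  move=> z hz.
  have [/val_inj -> //|/val_inj ->] : z = x :> nat \/ z = succN x :> nat.
    by move: hz => /=; lia.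
  by rewrite -nbx.
split.
  have [k ck] := (finite_setP _).1 fb.
  have k0 : 0 < k.
    case: k ck => // ; rewrite II0 card_eq0 => /eqP e.
    by move: xb; rewrite e.
  exists (toN k) => //; split; rewrite ?toN_val //; first exact: convex_block.
    by rewrite block_image card_set1.
  move=> Y cY [sY nsY]; apply/negP => Y1; apply: nsY.
  by apply: const_convex_sub_block => //; apply: sY.
case=> _ c1 _ _.
have us : uniq [:: x; succN x] by rewrite /= inE -(inj_eq val_inj) /=; lia.
suff /(card_ge_seq c1 us) : {in [:: x; succN x], forall y, block a x y} by [].
by move=> y; rewrite !inE => /orP[] /eqP->.
Qed.

(** Members are blocks of points, so there are at most countably many. Finitely many would have a
    bounded union, since each is finite; but a constant step beyond the bound, with a nonconstant
    step after it, yields another member. *)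
Lemma card_Mstar a :
  (forall m : natpos, exists2 x : natpos, m <= x & nb a x) ->
  (forall m : natpos, exists2 x : natpos, m <= x & ~ nb a x) ->
  Mstar a #= [set: nat].
Proof.
move=> nb_inf nnb_inf; apply: eq_card_nat.
  have sub : Mstar a `<=` (fun k => block a (toN k)) @` [set: nat].
    move=> X [/MM_block [x ->] _]; exists (x : nat) => //.
    by rewrite toN_natpos.
  exact: card_le_trans (subset_card_le sub) (card_image_le _ _).
move=> fM.
have : finite_set (\bigcup_(X in Mstar a) X).
  by apply: bigcup_finite => // X [[m _ [_ cX _ _]] _]; apply/finite_setP; exists m.
move=> /finite_has_bound[k hk].
have [x kx nbx] := nb_inf (toN k.+1).
have [m xm nbm] := nnb_inf x.
have : x <= k.
  by apply: hk; exists (block a x); [apply: block_Mstar nbx xm nbm|apply: block_refl].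
by move: kx; rewrite toN_val //; lia.
Qed.

(** * Generating the maps with a descending start *)

Lemma generated_finite_nb n g (m : nat) :
  FN g -> descends n g -> (forall x, nb g x -> x <= m) -> generated (Hn n) g.
Proof.
have [k] := ubnP m; elim: k m g => // k IH m g mk Fg dg nbm.
have [nb0|[x0 nbx0]] : (forall x, ~ nb g x) \/ exists x, nb g x.
  by case: (pselect (exists x, nb g x)) => [|/forallNP]; [right|left].
  apply: generated_sub; left; left; right; exact: descends_Lambda.
have st := (FN_step g).1 Fg.
have n0 := natpos_gt0 n.
have m0 : 0 < m by have := nbm _ nbx0; have := natpos_gt0 x0; lia.
have [nbM|nnbM] := pselect (nb g (toN m)); last first.
  apply: (IH m.-1) => //; first by lia.
  move=> x nbx; have := nbm _ nbx; rewrite leq_eqVlt => /orP[/eqP e|]; last by lia.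
  by case: nnbM; rewrite -e toN_natpos.
have nm := descends_nb dg nbM; rewrite toN_val // in nm.
have [i iE] : exists i : natpos, i = m.-1 :> nat.
  by exists (toN m.-1); rewrite toN_val //; lia.
have e1 : g (toN m) = g (toN m.+1) by rewrite nbM succN_toN.
have ne2 : g (toN m.+2) <> g (toN m.+1) :> nat.
  move=> /val_inj e; have /nbm : nb g (toN m.+1) by rewrite /nb /= succN_toN.
  by rewrite toN_val //; lia.
(* The nonconstant step at [m.+1] gives [g (toN m.+1)], which equals [g (toN m)], the parity of
   [m.+1]. A nonconstant step from [i] to [m] would give [g (toN m)] the parity of [m]. *)
have e0 : g i = g (toN m).
  apply/val_inj => /=.
  have := st i; have := st (toN m.+1).
  have -> : succN i = toN m by apply/val_inj; rewrite /= iE.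
  by rewrite succN_toN // -e1 iE !toN_val // => s1 s2; rewrite -e1 in ne2; lia.
have ni : n < i.
  by apply: (descends_nb dg); rewrite /nb /= e0; congr g; apply/val_inj; rewrite /= iE.
(* Cut the points [i + 1] and [i + 2] out of the domain: [g] agrees there with its value at [i], and
   [beta i] collapses exactly these three points. *)
pose h (x : natpos) := if x <= i then g x else g (toN (x + 2)).
have hle (x : natpos) : x <= i -> h x = g x by rewrite /h => ->.
have hgt (x : natpos) : i < x -> h x = g (toN (x + 2)) by rewrite /h ltnNge => /negbTE ->.
have hi : h (succN i) = g (toN m.+2).
  by rewrite hgt //; congr g; apply/val_inj; rewrite /= iE; lia.
have sgt (x : natpos) : toN (succN x + 2) = succN (toN (x + 2)).
  by apply/val_inj => /=; lia.
have -> : g = beta i \; h.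
  apply/funext => x /=; have := betaE i x; case: ltnP => xi bE.
    by rewrite (val_inj bE) hle // ltnW.
  move: bE; case: leqP => xi2 bE.
    rewrite (val_inj bE) hle //.
    have [e|[e|e]] : x = i :> nat \/ x = m :> nat \/ x = m.+1 :> nat by lia.
    - by rewrite (val_inj e).
    - by rewrite -[x]toN_natpos e e0.
    - by rewrite -[x]toN_natpos e e0 e1.
  rewrite hgt; last by rewrite bE; lia.
  by congr g; rewrite bE subnK ?toN_natpos //; lia.
apply: generated_comp.
  by apply: generated_sub; left; left; left; right; exists i => //; apply: ltnW.
(* At [i] the map [h] repeats the nonconstant step of [g] at [m.+1], and later steps of [h] are
   steps of [g] beyond [m]; so constant steps of [h] occur only below [i]. As [n < i], the
   descending start survives. *)
apply: (IH m.-2); first by lia.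
- apply/FN_step => x; have [xi|xi|e] := ltngtP x i.
  + by rewrite !hle ?(ltnW xi) //; apply: st.
  + rewrite !hgt ?(leqW xi) //.
    by rewrite sgt; have := st (toN (x + 2)); rewrite toN_val; lia.
  + rewrite (val_inj e) hi hle // e0 e1; have := st (toN m.+1).
    by rewrite succN_toN // !toN_val // iE; lia.
- have h1 : h (toN 1) = g (toN 1) by apply: hle; rewrite toN_val //; lia.
  split; rewrite h1; first by case: dg.
  by move=> x xn; rewrite hle; [apply: dg.2|apply: leq_trans ni].
- move=> x nbx; rewrite leqNgt; apply/negP => xm.
  have [xi|xi|e] := ltngtP x i.
  + by lia.
  + have /nbm : nb g (toN (x + 2)).
      by move: nbx; rewrite /nb /= !hgt ?(leqW xi) // sgt.
    by rewrite toN_val //; lia.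
  + move: nbx; rewrite /nb /= (val_inj e) hi hle // e0 e1 => /(congr1 natpos_val).
    by move/esym.
Qed.

Lemma generated_eventually_constant n g (m : natpos) :
  FN g -> descends n g -> (forall x : natpos, m <= x -> nb g x) ->
  generated (Hn n) g.
Proof.
move=> Fg dg nbm; have st := (FN_step g).1 Fg.
have gm (x : natpos) : m <= x -> g x = g m.
  have [k] := ubnP x; elim: k x => // k IH x xk mx.
  move: mx; rewrite leq_eqVlt => /orP[/eqP/val_inj -> //|mx].
  have m0 := natpos_gt0 m; have vE : toN x.-1 = x.-1 :> nat by rewrite toN_val //; lia.
  have xE : x = succN (toN x.-1) by apply/val_inj; move: vE => /=; lia.
  by rewrite xE -nbm ?IH ?vE //; lia.
(* The increasing tail must start where argument and value have equal parity, and beyond [n.+1] or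
   at it, to keep the descending start. *)
have [p [mp np pe]] : exists p : natpos, [/\ m <= p, n < p & odd p = odd (g m)].
  exists (toN ((m + n).*2 + odd (g m))).
  have := natpos_gt0 m; have := natpos_gt0 n => n0 m0.
  by rewrite toN_val; [split|]; lia.
pose h (x : natpos) := if x <= p then g x else toN (g m + (x - p)).
have hle (x : natpos) : x <= p -> h x = g x by rewrite /h => ->.
have hge (x : natpos) : p <= x -> h x = g m + (x - p) :> nat.
  rewrite leq_eqVlt => /orP[/eqP/val_inj <-|px].
    by rewrite hle // subnn addn0 gm.
  by rewrite /h leqNgt px toN_val //; have := natpos_gt0 (g m); lia.
have -> : g = alpha p \; h.
  apply/funext => x /=; rewrite /alpha; case: ltnP => xp.
    by rewrite hle // ltnW.
  by rewrite hle // !gm //; apply: leq_trans xp.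
apply: generated_comp.
  by apply: generated_sub; do 4! left; exists p => //; apply: ltnW.
have h1 : h (toN 1) = g (toN 1) by apply: hle; rewrite toN_val //; lia.
apply: (@generated_finite_nb _ _ p).
- apply/FN_step => x; have [xp|px] := ltnP x p.
    by rewrite !hle ?(ltnW xp) //; apply: st.
  by have := hge x px; have := hge (succN x) (leqW px) => /=; lia.
- split; rewrite h1; first by case: dg.
  by move=> x xn; rewrite hle; [apply: dg.2|apply: leq_trans np].
- move=> x nbx; rewrite leqNgt; apply/negP => px.
  have := hge x (ltnW px); have := hge (succN x) (leqW (ltnW px)).
  by rewrite -nbx /=; lia.
Qed.

Lemma generated_descends n g : FN g -> descends n g -> generated (Hn n) g.
Proof.
move=> Fg dg.
have [[m hm]|nbc] := pselect (exists m : natpos, forall x : natpos, m <= x -> nb g x).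
  exact: generated_eventually_constant hm.
have [[m hm]|nbf] := pselect (exists m : natpos, forall x : natpos, nb g x -> x <= m).
  exact: generated_finite_nb hm.
apply: generated_sub; left; right; split=> //.
- by case: dg.
- exact: descends_card_image.
(* Neither the constant nor the nonconstant steps are bounded here. *)
apply: card_Mstar => m; apply: contrapT => h.
  apply: nbf; exists m => x nbx; rewrite leqNgt; apply/negP => mx.
  by apply: h; exists x => //; apply: ltnW.
by apply: nbc; exists m => x mx; apply: contrapT => nbx; apply: h; exists x.
Qed.

(** * Prepending a descent to an arbitrary map *)

(* A map with [a 1] even starts with a constant block of even length, and [odd]
   lets the descent end with one more copy of [a 1] in that case. *)
Definition prefix_descent (n : natpos) (a : natpos -> natpos) (x : natpos) : natpos :=
  toN (if x <= n.*2 then a (toN 1) + n.*2 + odd (a (toN 1)) - x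
       else a (toN (x - n.*2))).

Lemma FN_prefix_descent n a : FN a -> FN (prefix_descent n a).
Proof.
move=> /FN_step st.
pose f k := if k <= n.*2 then a (toN 1) + n.*2 + odd (a (toN 1)) - k
            else a (toN (k - n.*2)).
have a1 := natpos_gt0 (a (toN 1)).
apply: (@FN_toN f) => k k0; rewrite /f.
  by case: ifP => kn; [lia|apply: natpos_gt0].
(* Since [a (toN 1) + odd (a (toN 1))] is even, values on the prefix have the parity of their
   argument. At [n.*2] the step to [a (toN 1)] goes down by one if that value is odd and is constant
   otherwise. *)
have [kn|kn|e] := ltngtP k n.*2.
- by lia.
- have := st (toN (k - n.*2)); rewrite succN_toN -?subSn ?(ltnW kn) //; last by lia.
  by rewrite toN_val; lia.
- by rewrite e subSnn; lia.
Qed.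

Lemma descends_prefix_descent n a : descends n (prefix_descent n a).
Proof.
have a1 := natpos_gt0 (a (toN 1)); have n0 := natpos_gt0 n.
(* As [n] is positive, [n.+1 <= n.*2], so these points all lie in the prefix. *)
have pE (x : natpos) : x <= n.+1 ->
    prefix_descent n a x = a (toN 1) + n.*2 + odd (a (toN 1)) - x :> nat.
  by move=> xn; rewrite /prefix_descent ifT ?toN_val; lia.
have := pE (toN 1); rewrite toN_val // => p1; split; first by lia.
by move=> x xn; rewrite pE // p1; lia.
Qed.

Theorem theorem3p3 (n : natpos) : generated (Hn n) = FN.
Proof.
apply/seteqP; split; first exact: smallest_sub FN_comp (@Hn_FN n).
move=> a Fa.
have := generated_shift n
  (generated_descends (FN_prefix_descent n Fa) (descends_prefix_descent n a)).
congr generated; apply/funext => x; have x0 := natpos_gt0 x.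
rewrite /prefix_descent toN_val; last by lia.
by rewrite ifF ?addnK ?toN_natpos //; lia.
Qed.
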